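(* Let $k$ be a field with $\operatorname{char}(k)\neq 2$, let $\lambda\in k$, and let $a,b,c\in k^*$ satisfy $ac=b^2$ and $bc\neq 1$. Then $L_{(a,b,c)}N^{\lambda}$ is conjugate (in the group of $k$-algebra automorphisms of $k[X,Y,Z]$) to $L_{(a,b,c)}$. In particular, choosing $\mu=bc\lambda(1-bc)^{-1}$, we have $$N^{-\mu}\,\bigl(L_{(a,b,c)}N^{\lambda}\bigr)\,N^{\mu}=L_{(a,b,c)}.$$
   Context: Let $k$ be a field with $\operatorname{char}(k)\ne 2$. Automorphisms of $k[X,Y,Z]$ are $k$-algebra automorphisms, written as the triple of images of $X,Y,Z$; the product $\varphi\psi$ is composition of maps on $k[X,Y,Z]$, i.e. $(\varphi\psi)(p)=\varphi(\psi(p))$. Put $\Delta=XZ+Y^2$. For $\lambda\in k$, $N^{\lambda}$ is the automorphism $$N^{\lambda}=(X-2\lambda Y\Delta-\lambda^2Z\Delta^2,\ Y+\lambda Z\Delta,\ Z),$$ which in characteristic $0$ equals $\exp(\lambda\Delta\delta)$ with $\delta=-2Y\partial_X+Z\partial_Y$; $N=N^1$ is the Nagata automorphism. For $a,b,c\in k^*$ with $ac=b^2$, $L_{(a,b,c)}=(aX,bY,cZ)$. *)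

(* Defs.v *)
From HB Require Import structures.
From mathcomp Require Import all_boot all_order all_algebra.
From mathcomp.classical Require boolp.
From mathcomp.multinomials Require Import mpoly.
From mathcomp Require Import ring.

Set Implicit Arguments.
Unset Strict Implicit.
Unset Printing Implicit Defensive.

Import GRing.Theory.

Local Open Scope ring_scope.

Section AlgebraAutomorphisms.
Variables (k : nzRingType) (A : lalgType k).

Definition is_alg_aut (f : A -> A) : Prop :=
  [/\ linear f, GRing.monoid_morphism f & bijective f].

Record alg_aut := AlgAut {
  alg_aut_fun :> A -> A;
  alg_autP : is_alg_aut alg_aut_fun
}.

Lemma alg_aut_eqP (f g : alg_aut) : f =1 g <-> f = g.
Proof.
split=> [|-> //]; case: f g => f fP [g gP] /= /boolp.funext eq_fg.
by rewrite -eq_fg in gP *; rewrite (boolp.Prop_irrelevance fP gP).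
Qed.

HB.instance Definition _ := boolp.gen_eqMixin alg_aut.
HB.instance Definition _ := boolp.gen_choiceMixin alg_aut.

Lemma is_alg_aut_id : is_alg_aut id.
Proof. by split=> //; exists id. Qed.

Lemma is_alg_aut_comp (f g : alg_aut) : is_alg_aut (f \o g).
Proof.
case: f g => f [fL [f1 fM] fB] [g [gL [g1 gM] gB]] /=.
split; last exact: bij_comp.
- by move=> a u v; rewrite /= gL fL.
- by split=> [|u v] /=; rewrite ?g1 // gM fM.
Qed.

Lemma alg_aut_inv_exists (f : alg_aut) :
  exists g : alg_aut, cancel f g /\ cancel g f.
Proof.
case: f => f [fL [f1 fM] fB]; case: (fB) => g fK gK.
suff gP : is_alg_aut g by exists (AlgAut gP).
have f_inj := can_inj fK; split; last by exists f.
- by move=> a u v; apply: f_inj; rewrite fL !gK.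
- by split=> [|u v]; apply: f_inj; rewrite ?f1 ?fM !gK.
Qed.

Definition alg_aut_one := AlgAut is_alg_aut_id.
Definition alg_aut_mul (f g : alg_aut) := AlgAut (is_alg_aut_comp f g).
Definition alg_aut_inv (f : alg_aut) : alg_aut :=
  sval (boolp.cid (alg_aut_inv_exists f)).

Lemma alg_aut_mulA : associative alg_aut_mul.
Proof. by move=> f g h; apply/alg_aut_eqP. Qed.
Lemma alg_aut_mul1 : left_id alg_aut_one alg_aut_mul.
Proof. by move=> f; apply/alg_aut_eqP. Qed.
Lemma alg_aut_mulr1 : right_id alg_aut_one alg_aut_mul.
Proof. by move=> f; apply/alg_aut_eqP. Qed.
Lemma alg_aut_mulV : left_inverse alg_aut_one alg_aut_inv alg_aut_mul.
Proof.
move=> f; apply/alg_aut_eqP => x /=; rewrite /alg_aut_inv.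
by case: (boolp.cid _) => g [fK gK] /=; rewrite fK.
Qed.
Lemma alg_aut_mulrV : right_inverse alg_aut_one alg_aut_inv alg_aut_mul.
Proof.
move=> f; apply/alg_aut_eqP => x /=; rewrite /alg_aut_inv.
by case: (boolp.cid _) => g [fK gK] /=; rewrite gK.
Qed.

HB.instance Definition _ := isGroup.Build alg_aut
  alg_aut_mulA alg_aut_mul1 alg_aut_mulr1 alg_aut_mulV alg_aut_mulrV.

End AlgebraAutomorphisms.

Definition conjugate (G : groupType) (x y : G) : Prop :=
  exists g : G, (x ^ g)%g = y.

Section NagataAutomorphisms.
Variable k : fieldType.

Local Notation P := {mpoly k[3]}.

Definition varX : P := 'X_(@Ordinal 3 0 isT).
Definition varY : P := 'X_(@Ordinal 3 1 isT).
Definition varZ : P := 'X_(@Ordinal 3 2 isT).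

(* The k-algebra endomorphism written (f, g, h), sending X, Y, Z to f, g, h. *)
Definition triple_endo (f g h : P) : P -> P :=
  fun p => p \mPo [tuple f; g; h].

Lemma triple_endoX f g h : triple_endo f g h varX = f.
Proof. by rewrite /triple_endo /varX comp_mpolyXU. Qed.
Lemma triple_endoY f g h : triple_endo f g h varY = g.
Proof. by rewrite /triple_endo /varY comp_mpolyXU. Qed.
Lemma triple_endoZ f g h : triple_endo f g h varZ = h.
Proof. by rewrite /triple_endo /varZ comp_mpolyXU. Qed.

Lemma triple_endo_morph f g h :
  linear (triple_endo f g h) /\ monoid_morphism (triple_endo f g h).
Proof.
rewrite /triple_endo; split=> [a u v|]; first by rewrite linearP.
by split=> [|u v]; rewrite ?rmorph1 ?rmorphM.
Qed.

Lemma alg_endo_idP (e : P -> P) :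
  linear e -> monoid_morphism e ->
  e varX = varX -> e varY = varY -> e varZ = varZ -> e =1 id.
Proof.
move=> eL [e1 eM] eX eY eZ p.
pose eS := GRing.isLinear.Build _ _ _ _ e eL.
pose eF : {linear P -> P} := HB.pack e eS.
have eXi i : e 'X_i = 'X_i.
  case: i => [[|[|[|//]]] ltn3]; rewrite (bool_irrelevance ltn3 isT).
  - exact: eX.
  - exact: eY.
  - exact: eZ.
have eXn i n : e ('X_i ^+ n) = 'X_i ^+ n.
  by elim: n => [|n IHn]; rewrite ?expr0 // exprS eM IHn eXi.
rewrite [p in LHS]mpolyE -[e]/(eF : P -> P) linear_sum [RHS]mpolyE.
apply: eq_bigr => m _; rewrite linearZ; congr (_ *: _) => /=.
rewrite mpolyXE_id (big_morph e eM e1).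
by apply: eq_bigr => i _; exact: eXn.
Qed.

Lemma triple_endo_aut f g h f' g' h' (F := triple_endo f g h)
    (F' := triple_endo f' g' h') :
  [/\ F f' = varX, F g' = varY & F h' = varZ] ->
  [/\ F' f = varX, F' g = varY & F' h = varZ] -> is_alg_aut F.
Proof.
move=> [Ff Fg Fh] [F'f F'g F'h].
have [FL [F1 FM]] := triple_endo_morph f g h.
have [F'L [F'1 F'M]] := triple_endo_morph f' g' h'.
split=> //; exists F'.
- apply: (alg_endo_idP (e := F' \o F)) => /=.
  + by move=> a u v /=; rewrite [F _]FL [F' _]F'L.
  + by split=> [|u v] /=; rewrite ?[F 1]F1 ?[F' 1]F'1 // [F _]FM [F' _]F'M.
  + by rewrite [F _]triple_endoX.
  + by rewrite [F _]triple_endoY.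
  + by rewrite [F _]triple_endoZ.
- apply: (alg_endo_idP (e := F \o F')) => /=.
  + by move=> a u v /=; rewrite [F' _]F'L [F _]FL.
  + by split=> [|u v] /=; rewrite ?[F' 1]F'1 ?[F 1]F1 // [F' _]F'M [F _]FM.
  + by rewrite [F' _]triple_endoX.
  + by rewrite [F' _]triple_endoY.
  + by rewrite [F' _]triple_endoZ.
Qed.

Definition Delta : P := varX * varZ + varY ^+ 2.

Definition nagata_endo (l : k) : P -> P :=
  triple_endo
    (varX - (2 * l) *: (varY * Delta) - (l ^+ 2) *: (varZ * Delta ^+ 2))
    (varY + l *: (varZ * Delta))
    varZ.

Definition diag_endo (a b c : k) : P -> P :=
  triple_endo (a *: varX) (b *: varY) (c *: varZ).

Lemma nagata_endo_aut l : is_alg_aut (nagata_endo l).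
Proof.
pose f l := varX - (2 * l) *: (varY * Delta) - l ^+ 2 *: (varZ * Delta ^+ 2).
pose g l := varY + l *: (varZ * Delta).
have cancel_fg u v : u + v = 0 -> let F := triple_endo (f u) (g u) varZ in
    [/\ F (f v) = varX, F (g v) = varY & F varZ = varZ].
  move=> /eqP; rewrite addrC addr_eq0 => /eqP -> F.
  have FX : F varX = f u := triple_endoX _ _ _.
  have FY : F varY = g u := triple_endoY _ _ _.
  have FZ : F varZ = varZ := triple_endoZ _ _ _.
  have FB p q : F (p - q) = F p - F q by rewrite /F /triple_endo rmorphB.
  have FD p q : F (p + q) = F p + F q by rewrite /F /triple_endo rmorphD.
  have FM p q : F (p * q) = F p * F q by rewrite /F /triple_endo rmorphM.
  have FE p n : F (p ^+ n) = F p ^+ n by rewrite /F /triple_endo rmorphXn.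
  have FS a p : F (a *: p) = a *: F p by rewrite /F /triple_endo linearZ.
  have FDelta : F Delta = Delta.
    rewrite {1}/Delta FD FM FE FX FY FZ /f /g -!mul_mpolyC.
    by rewrite !rmorphM ?rmorphXn /= -/Delta rmorph_nat /Delta; ring.
  split=> //; rewrite /f /g ?FB ?FD ?FS ?FM ?FE ?FDelta ?FX ?FY ?FZ.
    rewrite /f /g -!mul_mpolyC !(rmorphM, rmorphN, rmorphXn) /= rmorph_nat.
    by ring.
  by rewrite /g -!mul_mpolyC !rmorphN /=; ring.
by apply: (triple_endo_aut (f' := f (- l)) (g' := g (- l)) (h' := varZ));
  apply: cancel_fg; rewrite ?subrr ?addNr.
Qed.

Lemma diag_endo_aut (a b c : k) :
  a != 0 -> b != 0 -> c != 0 -> is_alg_aut (diag_endo a b c).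
Proof.
move=> a0 b0 c0; apply: (triple_endo_aut (f' := a^-1 *: varX)
  (g' := b^-1 *: varY) (h' := c^-1 *: varZ)); split;
  rewrite /triple_endo linearZ /= -/(triple_endo _ _ _ _)
    ?(triple_endoX, triple_endoY, triple_endoZ) scalerA
    ?mulVf ?mulfV ?scale1r //.
Qed.

Definition nagata (l : k) : alg_aut P := AlgAut (nagata_endo_aut l).

Definition diag_aut (a b c : k) (a0 : a != 0) (b0 : b != 0) (c0 : c != 0) :
  alg_aut P := AlgAut (diag_endo_aut a0 b0 c0).

End NagataAutomorphisms.

(* Main.v *)
Require Import Defs.
From HB Require Import structures.
From mathcomp Require Import all_boot all_order all_algebra.
From mathcomp.multinomials Require Import mpoly.
From mathcomp Require Import ring.
Import GRing.Theory.
Local Open Scope ring_scope.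

(** The idea is to move [nagata l] across the diagonal automorphism [L] and
    solve a linear equation for the parameter.  Since [a * c = b ^+ 2], [L]
    multiplies [Delta] by [b ^+ 2]; hence conjugation by [L] preserves the
    one-parameter group [l |-> nagata l] and only rescales its parameter:
    [L * nagata l = nagata (b * c * l) * L] ([diag_mul_nagata]).  As
    [nagata u * nagata v = nagata (u + v)] ([nagataD]), this gives
    [nagata (- mu) * (L * nagata lambda) * nagata mu
       = nagata (b * c * (lambda + mu) - mu) * L],
    and the parameter on the right vanishes exactly when
    [mu * (1 - b * c) = b * c * lambda], which is solvable because
    [b * c != 1].  Both commutation rules are polynomial identities on the
    images of the three variables, which determine an automorphism
    ([alg_aut_ext]). *)

Section NagataGroup.
Variable k : fieldType.
Local Notation P := {mpoly k[3]}.
Local Notation X := (varX k).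
Local Notation Y := (varY k).
Local Notation Z := (varZ k).
Implicit Types (f g h : P) (l u v : k).

(** [F^-1 * G] fixes the three variables, hence is the identity. *)
Lemma alg_aut_ext (F G : alg_aut P) :
  F X = G X -> F Y = G Y -> F Z = G Z -> F = G.
Proof.
move=> FGX FGY FGZ.
have FK p : (F^-1)%g (F p) = p.
  by have /alg_aut_eqP/(_ p) := mulVg F.
suff FVG : (F^-1 * G)%g = 1%g by rewrite -[G](mulVKg F) FVG mulg1.
have [FVGL FVGM _] := alg_autP (F^-1 * G)%g.
by apply/alg_aut_eqP/alg_endo_idP => //=; rewrite -(FGX, FGY, FGZ) FK.
Qed.

Lemma triple_Delta f g h : triple_endo f g h (Delta k) = f * h + g ^+ 2.
Proof.
rewrite /Delta /triple_endo rmorphD rmorphM rmorphXn /=.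
by rewrite !comp_mpolyXU.
Qed.

(** This and the next two lemmas compose an arbitrary triple with a Nagata
    automorphism, so that each identity between automorphisms becomes one
    between explicit polynomials. *)
Lemma triple_nagataX f g h l (D := f * h + g ^+ 2) :
  triple_endo f g h (nagata l X)
    = f - (2 * l) *: (g * D) - l ^+ 2 *: (h * D ^+ 2).
Proof.
rewrite /D -triple_Delta /= [nagata_endo _ _]triple_endoX /triple_endo.
rewrite !comp_mpolyB !comp_mpolyZ 2!rmorphM rmorphXn /=.
by rewrite !comp_mpolyXU.
Qed.

Lemma triple_nagataY f g h l :
  triple_endo f g h (nagata l Y) = g + l *: (h * (f * h + g ^+ 2)).
Proof.
rewrite -triple_Delta /= [nagata_endo _ _]triple_endoY /triple_endo.
rewrite comp_mpolyD comp_mpolyZ rmorphM /=.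
by rewrite !comp_mpolyXU.
Qed.

Lemma triple_nagataZ f g h l : triple_endo f g h (nagata l Z) = h.
Proof. by rewrite /= [nagata_endo _ _]triple_endoZ triple_endoZ. Qed.

Lemma nagata0 : nagata 0 = 1%g :> alg_aut P.
Proof.
apply: alg_aut_ext; rewrite /= /nagata_endo.
- by rewrite triple_endoX mulr0 expr0n /= !scale0r !subr0.
- by rewrite triple_endoY scale0r addr0.
- by rewrite triple_endoZ.
Qed.

(** [nagata u] fixes both [Z] and [Delta], so the shift of [Y] by
    [l *: (Z * Delta)] is additive in [l]; the image of [X] follows, as it is
    determined by the invariance of [Delta]. *)
Lemma nagataD u v : (nagata u * nagata v)%g = nagata (u + v) :> alg_aut P.
Proof.
apply: alg_aut_ext.
- rewrite [LHS]triple_nagataX [RHS]triple_endoX /Delta -!mul_mpolyC.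
  by rewrite !(rmorphM, rmorphXn, rmorphD) /=; ring.
- rewrite [LHS]triple_nagataY [RHS]triple_endoY /Delta -!mul_mpolyC.
  by rewrite !(rmorphM, rmorphXn, rmorphD) /=; ring.
- by rewrite [LHS]triple_nagataZ [RHS]triple_endoZ.
Qed.

Lemma nagataN u : nagata (- u) = (nagata u)^-1%g :> alg_aut P.
Proof. by apply/(mulIg (nagata u)); rewrite nagataD addNr nagata0 mulVg. Qed.

Lemma diag_mul_nagata (a b c l : k) (a0 : a != 0) (b0 : b != 0) (c0 : c != 0) :
  a * c = b ^+ 2 ->
  (diag_aut a0 b0 c0 * nagata l = nagata (b * c * l) * diag_aut a0 b0 c0)%g.
Proof.
move=> acb2.
(* Eliminating [a] turns the coefficient identities into ones in [b], [c] and
   [l] without a side condition other than [c != 0]. *)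
have aE : a = b ^+ 2 * c^-1 by rewrite -acb2 mulfK.
have DeltaE : (a *: X) * (c *: Z) + (b *: Y) ^+ 2 = b ^+ 2 *: Delta k.
  by rewrite -scalerAl -scalerAr scalerA acb2 exprZn -scalerDr.
have diagE p : (nagata (b * c * l) * diag_aut a0 b0 c0)%g p
               = nagata (b * c * l) (diag_endo a b c p) by [].
have nagZ u q p : nagata u (q *: p) = q *: nagata u p.
  by rewrite /= /nagata_endo /triple_endo linearZ.
apply: alg_aut_ext; rewrite diagE.
- rewrite [LHS]triple_nagataX DeltaE [diag_endo _ _ _ _]triple_endoX nagZ.
  rewrite [nagata _ X]triple_endoX !scalerBr !scalerA exprZn.
  rewrite -!scalerAl -!scalerAr !scalerA.
  by congr (_ - _ *: _ - _ *: _); rewrite aE; field.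
- rewrite [LHS]triple_nagataY DeltaE [diag_endo _ _ _ _]triple_endoY nagZ.
  rewrite [nagata _ Y]triple_endoY [RHS]scalerDr !scalerA.
  rewrite -!scalerAl -!scalerAr !scalerA.
  by congr (_ + _ *: _); ring.
- rewrite [LHS]triple_nagataZ [diag_endo _ _ _ _]triple_endoZ nagZ.
  by rewrite [nagata _ Z]triple_endoZ.
Qed.

End NagataGroup.

Theorem theorem3p3 (k : fieldType) (char_k : 2%N \notin [pchar k])
    (lambda a b c : k) (a0 : a != 0) (b0 : b != 0) (c0 : c != 0)
    (ac_b2 : a * c = b ^+ 2) (bc_neq1 : b * c != 1) :
  let L := diag_aut a0 b0 c0 in
  let mu := b * c * lambda * (1 - b * c)^-1 in
  conjugate (L * nagata lambda)%g L
  /\ (nagata (- mu) * (L * nagata lambda) * nagata mu)%g = L.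
Proof.
move=> L mu.
have NLN : (nagata (- mu) * (L * nagata lambda) * nagata mu)%g = L.
  rewrite -!mulgA nagataD diag_mul_nagata // mulgA nagataD.
  suff -> : - mu + b * c * (lambda + mu) = 0 by rewrite nagata0 mul1g.
  have bc1 : 1 - b * c != 0 by rewrite subr_eq0 eq_sym.
  by rewrite /mu; field.
by split=> //; exists (nagata mu); rewrite conjgE -nagataN mulgA.
Qed.
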